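(* Let $m>0$ and let $q:\mathbb{F}_2^{2m}\to\mathbb{F}_2$ be a quadratic (algebraic degree 2) bent function. Then the extended affine equivalence class of $q$ contains exactly two extended Cayley equivalence classes, and these correspond to the two possible weight classes of the functions $x\mapsto q(x+b)+\langle c,x\rangle+q(b)$, $b,c\in\mathbb{F}_2^{2m}$.
   Context: $\langle x,y\rangle=\sum_i x_iy_i$ over $\mathbb{F}_2$. A function $f:\mathbb{F}_2^{2m}\to\mathbb{F}_2$ is bent iff $|\sum_y(-1)^{f(y)+\langle x,y\rangle}|=2^m$ for all $x$. A bent function has weight ($|\{x:f(x)=1\}|$) either $2^{2m-1}-2^{m-1}$ (weight class 0) or $2^{2m-1}+2^{m-1}$ (weight class 1). The extended affine equivalence class of $q$ is $\{x\mapsto q(Ax+b)+\langle c,x\rangle+\delta : A\in GL(2m,2),\ b,c\in\mathbb{F}_2^{2m},\ \delta\in\mathbb{F}_2\}$. For $u$ with $u(0)=0$, $\mathrm{Cay}(u)$ is the simple graph on $\mathbb{F}_2^{2m}$ with $i\sim j$ iff $u(i+j)=1$; functions $f,g$ are extended Cayley equivalent iff $\mathrm{Cay}(f+f(0))\cong\mathrm{Cay}(g+g(0))$. *)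

(* Defs.v *)
From HB Require Import structures.
From mathcomp Require Import all_boot all_order all_algebra all_fingroup.

Set Implicit Arguments.
Unset Strict Implicit.
Unset Printing Implicit Defensive.

Import GRing.Theory Num.Theory.
Local Open Scope ring_scope.

Notation bvec n := 'cV['F_2]_n.

Notation bfun n := {ffun 'cV['F_2]_n -> 'F_2}.

Definition dotp n (x y : bvec n) : 'F_2 := \sum_i x i 0 * y i 0.

(* The exponent is the representative in {0, 1} of an element of 'F_2. *)
Definition walsh n (f : bfun n) (x : bvec n) : int :=
  \sum_(y : bvec n) (-1) ^+ nat_of_ord (f y + dotp x y).

Definition bent m (f : bfun (2 * m)%N) : Prop :=
  forall x : bvec (2 * m)%N, `|walsh f x| = 2 ^+ m.

Definition weight n (f : bfun n) : nat := #|[set x | f x == 1]|.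

(* [i = false] is weight class 0 and [i = true] is weight class 1; the
   natural-number exponents and difference are exact as soon as 0 < m. *)
Definition in_weight_class m (i : bool) (f : bfun (2 * m)%N) : bool :=
  weight f == (if i then 2 ^ (2 * m - 1) + 2 ^ (m - 1)
               else 2 ^ (2 * m - 1) - 2 ^ (m - 1))%N.

(* Algebraic normal form: [a S] is the coefficient of the squarefree monomial
   with variables indexed by S.  Every f has exactly one such [a], so the
   existential in [has_alg_degree] involves no choice. *)
Definition anf_eval n (a : {ffun {set 'I_n} -> 'F_2}) (x : bvec n) : 'F_2 :=
  \sum_(S : {set 'I_n}) a S * \prod_(i in S) x i 0.

Definition has_alg_degree n (f : bfun n) (d : nat) : Prop :=
  exists a : {ffun {set 'I_n} -> 'F_2},
    (forall x, f x = anf_eval a x) /\ (\max_(S | a S != 0%R) #|S| = d)%N.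

Definition ea_map n (q : bfun n) (A : 'M['F_2]_n) (b c : bvec n) (d : 'F_2) :
  bfun n := [ffun x => q (A *m x + b) + dotp c x + d].

Definition ea_class n (q : bfun n) : {set bfun n} :=
  [set g | [exists A : 'M['F_2]_n, exists b : bvec n, exists c : bvec n,
            exists d : 'F_2, (A \in unitmx) && (g == ea_map q A b c d)]].

Definition et_map n (q : bfun n) (b c : bvec n) : bfun n :=
  [ffun x => q (x + b) + dotp c x + q b].

Definition et_class n (q : bfun n) : {set bfun n} :=
  [set et_map q b c | b : bvec n, c : bvec n].

Definition graph_iso (T : finType) (e e' : rel T) : bool :=
  [exists s : {perm T}, forall x, forall y, e x y == e' (s x) (s y)].

Definition cay n (u : bfun n) : rel (bvec n) := fun i j => u (i + j) == 1.

Definition normalize0 n (f : bfun n) : bfun n := [ffun x => f x + f 0].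

Definition ec_equiv n : rel (bfun n) :=
  fun f g => graph_iso (cay (normalize0 f)) (cay (normalize0 g)).

Lemma cay_sym n (u : bfun n) : symmetric (cay u).
Proof. by move=> i j; rewrite /cay addrC. Qed.

Lemma addrr_F2 n (x : bvec n) : x + x = 0.
Proof.
have F2 (a : 'F_2) : a + a = 0 by case: a => [[|[|[]]]] // ?; apply: val_inj.
by apply/matrixP=> i j; rewrite !mxE F2.
Qed.

Lemma cay_irr n (u : bfun n) : u 0 = 0 -> irreflexive (cay u).
Proof. by move=> u0 i; rewrite /cay addrr_F2 u0. Qed.

Lemma normalize0_at0 n (f : bfun n) : normalize0 f 0 = 0.
Proof.
by rewrite ffunE; case: (f 0) => [[|[|[]]]] // ?; apply: val_inj.
Qed.

Lemma graph_iso_refl (T : finType) : reflexive (@graph_iso T).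
Proof.
move=> e; apply/existsP; exists 1%g.
by apply/forallP=> x; apply/forallP=> y; rewrite !perm1.
Qed.

Lemma graph_iso_sym (T : finType) : symmetric (@graph_iso T).
Proof.
suff H (e e' : rel T) : graph_iso e e' -> graph_iso e' e.
  by move=> e e'; apply/idP/idP; apply: H.
case/existsP=> s /forallP Hs; apply/existsP; exists (s^-1)%g.
apply/forallP=> x; apply/forallP=> y.
by have /forallP/(_ (s^-1 y)%g) := Hs (s^-1 x)%g; rewrite !permKV eq_sym.
Qed.

Lemma graph_iso_trans (T : finType) : transitive (@graph_iso T).
Proof.
move=> e2 e1 e3 /existsP[s /forallP Hs] /existsP[t /forallP Ht].
apply/existsP; exists (s * t)%g; apply/forallP=> x; apply/forallP=> y.
rewrite !permM; have /forallP/(_ y)/eqP-> := Hs x.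
by have /forallP/(_ (s y)) := Ht (s x).
Qed.

Lemma ec_equiv_equivalence n : equivalence_rel (@ec_equiv n).
Proof.
apply/equivalence_relP; split=> [f|f g fg h]; first exact: graph_iso_refl.
by apply/idP/idP; apply: graph_iso_trans; rewrite // graph_iso_sym.
Qed.

(* Main.v *)
(** Let B be the polar form of q.  It is bilinear because q is quadratic and
    nondegenerate because q is bent, so after removal of its constant term
    each member of the class of q becomes Q_a o A with A linear and
    Q_a(x) = q(x) + q(0) + B(a, x) = q(x + a) + q(a).  If q(a) = q(b), then the
    transvection x |-> x + B(a + b, x)(a + b) carries Q_a to Q_b, and hence is
    an isomorphism of Cayley graphs.  If q(a) <> q(b), then Q_b is the
    complement of a translate of Q_a, so the two weights add up to 2^(2m); they are
    distinct by bentness.  Isomorphic Cayley graphs have the same degree, which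
    is the weight. *)

Require Import Defs.
From HB Require Import structures.
From mathcomp Require Import all_boot all_order all_algebra all_fingroup.
From mathcomp Require Import zify.

Set Implicit Arguments.
Unset Strict Implicit.
Unset Printing Implicit Defensive.

Import GRing.Theory Num.Theory.
Local Open Scope ring_scope.

(** * Arithmetic in F_2 and the scalar product *)

Lemma F2P (a : 'F_2) : a = 0 \/ a = 1.
Proof. by case: a => [[|[|[]]]] // ?; [left|right]; apply: val_inj. Qed.

Lemma addrr_in_F2 (a : 'F_2) : a + a = 0.
Proof. by case: (F2P a) => ->; apply: val_inj. Qed.

(** Exhausts the values of the leading variables; the last two alternatives serve a goal with one
    equational premise, false or true. *)
Ltac F2_cases :=
  first [ let a := fresh in move=> a; case: (F2P a) => {a}->; F2_cases
        | exact: val_inj | by move/(congr1 val) | by move=> _; apply: val_inj ].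

Lemma bvec_addKr n (x y : bvec n) : x + y + y = x.
Proof. by rewrite -addrA addrr_F2 addr0. Qed.

Lemma dotpD n (c x y : bvec n) : dotp c (x + y) = dotp c x + dotp c y.
Proof. by rewrite -big_split; apply: eq_bigr => i _; rewrite mxE mulrDr. Qed.

Lemma dotp0 n (c : bvec n) : dotp c 0 = 0.
Proof. by apply: big1 => i _; rewrite mxE mulr0. Qed.

Lemma dotp0l n (x : bvec n) : dotp 0 x = 0.
Proof. by apply: big1 => i _; rewrite mxE mul0r. Qed.

Lemma dotpE n (c x : bvec n) : dotp c x = (c^T *m x) 0 0.
Proof. by rewrite mxE; apply: eq_bigr => i _; rewrite mxE. Qed.

Lemma dotp_mulmxr n (A : 'M['F_2]_n) (c x : bvec n) :
  dotp c (A *m x) = dotp (A^T *m c) x.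
Proof. by rewrite !dotpE mulmxA trmx_mul trmxK. Qed.

Lemma dotp_surj n (a : bvec n) (e : 'F_2) :
  a != 0 -> exists u, dotp u a = e.
Proof.
move=> a0; have [i ai] : exists i, a i 0 != 0.
  apply/existsP; apply: contraNT a0; rewrite negb_exists => /forallP H.
  apply/eqP/matrixP => i j; rewrite (ord1 j) !mxE.
  by apply/eqP; have := H i; rewrite negbK.
have ai1 : a i 0 = 1 by case: (F2P (a i 0)) ai => -> //; rewrite eqxx.
exists (e *: delta_mx i 0); rewrite /dotp (bigD1 i) //= big1 => [|j ji].
  by rewrite !mxE !eqxx ai1 !mulr1 addr0.
by rewrite !mxE (negPf ji) mulr0 mul0r.
Qed.

Lemma card_bvec n : #|{: bvec n}| = (2 ^ n)%N.
Proof. by rewrite card_mx card_Fp // muln1. Qed.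

(** * Quadratic functions *)

(* The vanishing of third derivatives is the form in which degree at most two
   is used. *)
Lemma quadratic_third_derivative n (f : bfun n) :
  has_alg_degree f 2 -> forall x y z,
  f (x + y + z) = f (x + y) + f (x + z) + f (y + z) + f x + f y + f z + f 0.
Proof.
case=> a [fE deg] x y z; rewrite !fE /anf_eval -!big_split /=.
apply: eq_bigr => S _; have [->|aS] := eqVneq (a S) 0.
  by rewrite !mul0r !addr0.
rewrite -!mulrDr; congr (_ * _).
have : (#|S| <= 2)%N by rewrite -deg (leq_bigmax_cond S).
rewrite leq_eqVlt => /orP[/cards2P[i [j [ij ->]]]|].
  rewrite !big_setU1 ?inE //= !big_set1 !mxE.
  move: (x i 0) (x j 0) (y i 0) (y j 0) (z i 0) (z j 0).
  by F2_cases.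
rewrite ltnS leq_eqVlt => /orP[/cards1P[i ->]|].
  rewrite !big_set1 !mxE; move: (x i 0) (y i 0) (z i 0).
  by F2_cases.
(* The empty monomial occurs seven times on the right, and seven is odd. *)
rewrite ltnS leqn0 cards_eq0 => /eqP->; rewrite !big_set0.
exact: val_inj.
Qed.

(** The summand [q 0] keeps the form bilinear for a quadratic [q] with [q 0 = 1]. *)
Definition polar n (q : bfun n) (x y : bvec n) : 'F_2 :=
  q (x + y) + q x + q y + q 0.

Lemma polarC n (q : bfun n) x y : polar q x y = polar q y x.
Proof. by rewrite /polar [y + x]addrC [_ + q y + q x]addrAC. Qed.

Lemma polarxx n (q : bfun n) x : polar q x x = 0.
Proof.
rewrite /polar addrr_F2; move: (q x) (q 0).
by F2_cases.
Qed.

Section Quadratic.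

Variables (n : nat) (q : bfun n).
Hypothesis q_quad : has_alg_degree q 2.

Lemma polarDr x y z : polar q x (y + z) = polar q x y + polar q x z.
Proof.
rewrite /polar addrA (quadratic_third_derivative q_quad).
move: (q (x + y)) (q (x + z)) (q (y + z)) (q x) (q y) (q z) (q 0).
by F2_cases.
Qed.

Lemma polarDl x y z : polar q (x + y) z = polar q x z + polar q y z.
Proof. by rewrite ![polar q _ z]polarC polarDr. Qed.

Lemma polar0r x : polar q x 0 = 0.
Proof. by rewrite -(addrr_F2 0) polarDr addrr_in_F2. Qed.

Lemma polarZr x e y : polar q x (e *: y) = e * polar q x y.
Proof.
by case: (F2P e) => ->; rewrite ?scale0r ?scale1r ?mul0r ?mul1r ?polar0r.
Qed.

Definition polar_dual (a : bvec n) : bvec n :=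
  \col_i polar q a (delta_mx i 0).

Lemma polar_dualE a x : polar q a x = dotp (polar_dual a) x.
Proof.
have {1}-> : x = \sum_i x i 0 *: delta_mx i 0.
  by rewrite {1}[x]matrix_sum_delta; apply: eq_bigr => i _; rewrite big_ord1.
rewrite (big_morph (polar q a) (polarDr a) (polar0r a)).
by apply: eq_bigr => i _; rewrite mxE polarZr mulrC.
Qed.

(** This is the Q_a of the overview. The linear term is suited to affine changes, while
    [shift_formE] exposes a translate, whose weight is easy to compare. *)
Definition shift_form (a : bvec n) : bfun n :=
  [ffun x => q x + q 0 + polar q a x].

Lemma shift_formE a x : shift_form a x = q (x + a) + q a.
Proof.
rewrite ffunE /polar [a + x]addrC.
move: (q (x + a)) (q x) (q a) (q 0); F2_cases.
Qed.

Definition transvection (d x : bvec n) : bvec n := x + polar q d x *: d.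

Lemma transvectionD d x y :
  transvection d (x + y) = transvection d x + transvection d y.
Proof. by rewrite /transvection polarDr scalerDl addrACA. Qed.

(** Since [polar q] is alternating, the map leaves [polar q d x] unchanged; a second application
    adds the same multiple of [d], which cancels in characteristic 2. *)
Lemma transvectionK d : involutive (transvection d).
Proof.
move=> x; rewrite /transvection polarDr polarZr polarxx mulr0 addr0.
by rewrite bvec_addKr.
Qed.

(** If [polar q (a + b) x] is 0, then [x] is fixed and the linear terms of both forms agree at [x].
    If it is 1, then [x] moves to [x + (a + b)], whose translate by [a] is [x + b]. *)
Lemma shift_form_transvection a b x : q a = q b ->
  shift_form a (transvection (a + b) x) = shift_form b x.
Proof.
move=> qab; rewrite /transvection.
case: (F2P (polar q (a + b) x)) => Bx; rewrite Bx.
  rewrite scale0r addr0 !ffunE; congr (_ + _).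
  have := Bx; rewrite polarDl; move: (polar q a x) (polar q b x) => u v.
  by case: (F2P u) => ->; case: (F2P v) => ->.
rewrite scale1r !shift_formE qab; congr (_ + _).
by rewrite [a + b]addrC addrA bvec_addKr.
Qed.

End Quadratic.

(** * Cayley graphs and weights *)

Lemma graph_iso_degree (T : finType) (e e' : rel T) : graph_iso e e' ->
  exists s : {perm T}, forall x, #|[set y | e x y]| = #|[set y | e' (s x) y]|.
Proof.
case/existsP=> s /forallP iso; exists s => x.
rewrite -(card_imset _ (@perm_inj _ s)); apply: eq_card => y.
rewrite -[y](permKV s) mem_imset ?inE; last exact: perm_inj.
by have /forallP/(_ (s^-1%g y))/eqP := iso x.
Qed.

Lemma cay_degree n (u : bfun n) x : #|[set y | cay u x y]| = weight u.
Proof.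
rewrite /weight -[RHS](card_imset _ (@addrI _ x)); apply: eq_card => y.
have yE : y = x + (x + y) by rewrite addrA addrr_F2 add0r.
by rewrite inE [in RHS]yE mem_imset ?inE //; exact: addrI.
Qed.

Lemma cay_iso_weight n (u v : bfun n) :
  graph_iso (cay u) (cay v) -> weight u = weight v.
Proof. by case/graph_iso_degree=> s /(_ 0); rewrite !cay_degree. Qed.

(** Adjacency depends only on the sum of the endpoints, and [s] respects sums. *)
Lemma cay_iso_additive n (u v : bfun n) (s : bvec n -> bvec n) :
  injective s -> {morph s : x y / x + y} -> (forall x, v (s x) = u x) ->
  graph_iso (cay u) (cay v).
Proof.
move=> sI sD vs; apply/existsP; exists (perm sI).
by apply/forallP=> x; apply/forallP=> y; rewrite !permE /cay -sD vs.
Qed.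

Lemma weight_shift n (f g : bfun n) (a : bvec n) (e : 'F_2) :
  (forall x, g x = f (x + a) + e) ->
  weight g = if e == 0 then weight f else (2 ^ n - weight f)%N.
Proof.
move=> gE; rewrite /weight -card_bvec.
have cC (A : {set bvec n}) : (#|{: bvec n}| - #|A| = #|~: A|)%N.
  by rewrite [RHS]cardsCs setCK.
rewrite cC.
have addI : injective (fun x : bvec n => x + a) by exact: addIr.
rewrite -(card_imset [set x | g x == 1] addI).
case: (F2P e) gE => -> gE; rewrite ?eqxx /=; last first.
  apply: eq_card => x; rewrite -[x](bvec_addKr _ a) (mem_imset _ _ addI) !inE gE.
  by rewrite bvec_addKr; case: (F2P (f x)) => ->.
apply: eq_card => x; rewrite -[x](bvec_addKr _ a) (mem_imset _ _ addI) !inE gE.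
by rewrite addr0.
Qed.

Lemma walsh0 n (f : bfun n) :
  walsh f 0 = (2 ^ n)%N%:Z - (2 * weight f)%N%:Z.
Proof.
have wE : walsh f 0 = \sum_y (-1) ^+ nat_of_ord (f y).
  apply: eq_bigr => y _; congr (_ ^+ nat_of_ord _).
  by rewrite dotp0l; exact: addr0.
rewrite wE /weight -card_bvec; set A := [set x | f x == 1].
rewrite -(cardsC A) (bigID (fun x => x \in A)) /=.
have -> : \sum_(x in A) (-1) ^+ nat_of_ord (f x) = - (#|A|%:Z) :> int.
  rewrite (eq_bigr (fun=> -1)) => [|x]; last by rewrite inE => /eqP->.
  by rewrite sumr_const mulNrn natz.
have -> : \sum_(x | x \notin A) (-1) ^+ nat_of_ord (f x) = #|~: A|%:Z :> int.
  rewrite (eq_bigr (fun=> 1)) => [|x]; last first.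
    by rewrite inE; case: (F2P (f x)) => ->.
  rewrite (eq_bigl (fun x => x \in ~: A)) => [|x]; last by rewrite in_setC.
  by rewrite sumr_const natz.
by move: #|A| #|~: A| => u v; lia.
Qed.

Lemma bent_weight_cases m (f : bfun (2 * m)%N) : (0 < m)%N -> bent f ->
  exists i, in_weight_class i f.
Proof.
case: m f => // m f _ /(_ 0); rewrite walsh0 /in_weight_class.
move: (weight f) => w.
have -> : (2 * m.+1 - 1 = m + m.+1)%N by lia.
have -> : (2 * m.+1 = m.+1 + m.+1)%N by lia.
rewrite subn1 /= !expnD !expnS !exprS.
have -> : (2 : int) ^+ m = (2 ^ m)%N%:Z by rewrite -natz natrX.
(* Here [m] is the predecessor of the original one, and bentness at 0 reads |4K^2 - 2w| = 2K. *)
have := expn_gt0 2 m; move: (2 ^ m)%N => K /= K0 H.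
have [|] : w = (2 * (K * K) - K)%N \/ w = (2 * (K * K) + K)%N by nia.
  by move=> ->; exists false; apply/eqP; nia.
by move=> ->; exists true; apply/eqP; nia.
Qed.

Lemma weight_class_compl m i (f g : bfun (2 * m)%N) : (0 < m)%N ->
  weight g = (2 ^ (2 * m) - weight f)%N ->
  in_weight_class i f -> in_weight_class (~~ i) g.
Proof.
case: m f g => // m f g _; rewrite /in_weight_class => ->.
move: (weight f) => w.
have -> : (2 * m.+1 - 1 = m + m.+1)%N by lia.
have -> : (2 * m.+1 = m.+1 + m.+1)%N by lia.
rewrite subn1 /= !expnD !expnS => /eqP->.
have := expn_gt0 2 m; move: (2 ^ m)%N => K /= K0; apply/eqP.
by case: i => /=; nia.
Qed.

(** The two admissible weights differ by [2 ^ m], which is positive. *)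
Lemma in_weight_class_uniq m i j (f : bfun (2 * m)%N) : (0 < m)%N ->
  in_weight_class i f -> in_weight_class j f = (i == j).
Proof.
case: m f => // m f _; rewrite /in_weight_class.
move: (weight f) => w.
have -> : (2 * m.+1 - 1 = m + m.+1)%N by lia.
rewrite subn1 /= !expnD !expnS => /eqP->.
have := expn_gt0 2 m; move: (2 ^ m)%N => K /= K0.
by case: i; case: j; rewrite ?eqxx //=; apply/negbTE/eqP; nia.
Qed.

(** * The extended affine class of a quadratic bent function *)

Section QuadraticBent.

Variables (m : nat) (q : bfun (2 * m)%N).
Hypotheses (m_gt0 : (0 < m)%N) (q_quad : has_alg_degree q 2) (q_bent : bent q).

(* If a lies in the radical, then translation by a multiplies the terms of a
   suitable Walsh sum by -1, so that this sum vanishes. *)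
Lemma polar_nondegenerate a : (forall x, polar q a x = 0) -> a = 0.
Proof.
(* The value of [dotp u a] is chosen so that, added to the change [q a + q 0] of [q] under
   translation by [a], it gives 1. *)
move=> a_rad; apply/eqP; apply: contraT => /(dotp_surj (1 + q a + q 0)) [u ua].
have qD x : q (x + a) = q x + q a + q 0.
  have := a_rad x; rewrite /polar addrC [a + x]addrC.
  by move: (q (x + a)) (q x) (q a) (q 0); F2_cases.
have wN : walsh q u = - walsh q u.
  rewrite {1}/walsh (reindex_inj (addIr a)) /= -sumrN; apply: eq_bigr => x _.
  rewrite dotpD ua qD; move: (q x) (q a) (q 0) (dotp u x) => a1 a2 a3 a4.
  by case: (F2P a1) => ->; case: (F2P a2) => ->; case: (F2P a3) => ->;
     case: (F2P a4) => ->.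
have := q_bent u; have -> : walsh q u = 0 by lia.
by move/eqP; rewrite normr0 eq_sym expf_eq0 andbF.
Qed.

(** Nondegeneracy makes [polar_dual q] injective, hence bijective on a finite space. Linear terms
    can thus be traded for translations of [q]. *)
Lemma dotp_polar c : exists a, forall x, dotp c x = polar q a x.
Proof.
have dualI : injective (polar_dual q).
  move=> a b ab.
  have /polar_nondegenerate/eqP : forall x, polar q (a + b) x = 0.
    move=> x; rewrite polarDl // !(polar_dualE q_quad) ab.
    exact: addrr_in_F2.
  by move=> /eqP ab0; rewrite -[a](bvec_addKr _ b) ab0 add0r.
have [dual' _ dualK] := injF_bij dualI.
by exists (dual' c) => x; rewrite polar_dualE // dualK.
Qed.

Lemma normalize0_ea g : g \in ea_class q ->
  exists (A : 'M_(2 * m)) a, A \in unitmx /\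
    forall x, normalize0 g x = shift_form q a (A *m x).
Proof.
rewrite inE => /existsP[A /existsP[b /existsP[c /existsP[d]]]].
(* As a functional of [A *m x], the term [dotp c x] is represented by the inverse transpose of [A]
   applied to [c]. *)
case/andP=> Au /eqP->; have [a aE] := dotp_polar ((invmx A)^T *m c).
exists A, (b + a); split=> // x.
rewrite !ffunE polarDl // -aE -dotp_mulmxr mulKmx //.
rewrite /polar mulmx0 add0r dotp0 [b + _]addrC.
move: (q _) (q b) (q _) (q 0) (dotp c x) => a1 a2 a3 a4 a5.
by move: a1 a2 a3 a4 a5 d; F2_cases.
Qed.

Lemma cay_iso_ea g (A : 'M_(2 * m)) a : A \in unitmx ->
  (forall x, normalize0 g x = shift_form q a (A *m x)) ->
  graph_iso (cay (normalize0 g)) (cay (shift_form q a)).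
Proof.
move=> Au gE; apply: (@cay_iso_additive _ _ _ (mulmx A)) => //.
- exact: can_inj (mulKmx Au).
- exact: mulmxDr.
Qed.

Lemma cay_iso_shift_form a b : q a = q b ->
  graph_iso (cay (shift_form q b)) (cay (shift_form q a)).
Proof.
move=> qab; apply: (@cay_iso_additive _ _ _ (transvection q (a + b))).
- exact: inv_inj (transvectionK q_quad _).
- exact: transvectionD.
- by move=> x; exact: shift_form_transvection.
Qed.

Lemma weight_shift_form_neq a b i : q a != q b ->
  in_weight_class i (shift_form q a) -> in_weight_class (~~ i) (shift_form q b).
Proof.
move=> qab; apply: weight_class_compl => //.
(* Translation by [a + b] aligns the arguments of [q]; the constants left over, [q a] and [q b],
   differ by 1. *)
rewrite (@weight_shift _ (shift_form q a) (shift_form q b) (a + b) 1) // => x.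
rewrite !shift_formE [a + b]addrC (addrA x) bvec_addKr.
move: (q (x + b)) qab => u.
by case: (F2P (q a)) => ->; case: (F2P (q b)) => ->; case: (F2P u) => ->;
   rewrite ?eqxx // => _; apply: val_inj.
Qed.

(** The form at 0 is [q] or its complement, so bentness gives it a class; any [b] with [q b]
    different from [q 0] supplies the opposite one. *)
Lemma shift_form_weight_class i : exists a, in_weight_class i (shift_form q a).
Proof.
have [j qj] := bent_weight_cases m_gt0 q_bent.
have [b qb] : exists b, q b != q 0.
  apply/existsP; apply: contraT => /existsPn q_const.
  (* A constant [q] would have zero polar form, which is degenerate because the space is nonzero. *)
  have q_flat : polar q =2 fun _ _ => 0.
    move=> x y; rewrite /polar !(eqP (negbNE (q_const _))).
    by move: (q 0); F2_cases.
  have i0 : (0 < 2 * m)%N by rewrite muln_gt0.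
  have /(congr1 (fun v : bvec _ => v (Ordinal i0) 0)) :
    delta_mx (Ordinal i0) 0 = 0 :> bvec (2 * m).
    by apply: polar_nondegenerate => x; exact: q_flat.
  by rewrite !mxE !eqxx.
have [k k0] : exists k, in_weight_class k (shift_form q 0).
  exists (if q 0 == 0 then j else ~~ j).
  have w0 : weight (shift_form q 0) =
      if q 0 == 0 then weight q else (2 ^ (2 * m) - weight q)%N.
    by apply: (weight_shift (a := 0)) => x; rewrite shift_formE.
  case: ifP w0 => _ w0; first by rewrite /in_weight_class w0.
  exact: weight_class_compl w0 qj.
have [<-|ki] := eqVneq k i; first by exists 0.
exists b; have -> : i = ~~ k by case: k i ki {k0} => [] [].
by apply: (weight_shift_form_neq _ k0); rewrite eq_sym.
Qed.

Lemma ea_weight_class g : g \in ea_class q ->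
  exists i, in_weight_class i (normalize0 g).
Proof.
case/normalize0_ea=> A [a [Au gE]].
have wg := cay_iso_weight (cay_iso_ea Au gE).
(* One form of class 1 serves as reference: equal values of [q] give the same class, different
   values the other. *)
have [b wb] := shift_form_weight_class true.
rewrite /in_weight_class wg; have [qab|qab] := eqVneq (q b) (q a).
  by exists true; rewrite (cay_iso_weight (cay_iso_shift_form qab)).
by exists false; exact: weight_shift_form_neq wb.
Qed.

Lemma ec_equiv_weight_class g h i : g \in ea_class q -> h \in ea_class q ->
  in_weight_class i (normalize0 g) ->
  ec_equiv g h = in_weight_class i (normalize0 h).
Proof.
move=> gq hq wg; apply/idP/idP.
  by rewrite /in_weight_class => /cay_iso_weight <-.
have [A [a [Au gE]]] := normalize0_ea gq.
have [B [b [Bu hE]]] := normalize0_ea hq.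
have iso_g := cay_iso_ea Au gE; have iso_h := cay_iso_ea Bu hE; move=> wh.
apply: (graph_iso_trans iso_g); rewrite graph_iso_sym.
apply: (graph_iso_trans iso_h); apply: cay_iso_shift_form.
(* Different values of [q] would put the two forms in opposite classes. *)
apply/eqP; apply: contraT => qab.
have wa : in_weight_class i (shift_form q a).
  by rewrite /in_weight_class -(cay_iso_weight iso_g).
have wb : in_weight_class i (shift_form q b).
  by rewrite /in_weight_class -(cay_iso_weight iso_h).
have := in_weight_class_uniq (~~ i) m_gt0 wb.
by rewrite (weight_shift_form_neq qab wa); case: (i).
Qed.

Lemma et_class_sub : et_class q \subset ea_class q.
Proof.
apply/subsetP=> _ /imset2P[b c _ _ ->]; rewrite inE.
apply/existsP; exists 1%:M; apply/existsP; exists b.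
apply/existsP; exists c; apply/existsP; exists (q b).
by rewrite unitmx1; apply/eqP/ffunP => x; rewrite !ffunE mul1mx.
Qed.

End QuadraticBent.

(** The constant [q b] makes these functions vanish at 0, so their weight classes can be read
    without normalization. *)
Lemma normalize0_et n (q g : bfun n) : g \in et_class q -> normalize0 g = g.
Proof.
case/imset2P=> b c _ _ ->; apply/ffunP => x; rewrite !ffunE dotp0 add0r.
by rewrite addr0 addrr_in_F2 addr0.
Qed.

Lemma shift_form_et n (q : bfun n) a : shift_form q a \in et_class q.
Proof.
apply/imset2P; exists a 0 => //; apply/ffunP => x.
by rewrite shift_formE ffunE dotp0l addr0.
Qed.

Theorem mainTheorem6 (m : nat) (hm : (0 < m)%N) (q : bfun (2 * m)%N)
    (hbent : bent q) (hquad : has_alg_degree q 2) :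
  let P := equivalence_partition (@ec_equiv (2 * m)%N) (ea_class q) in
  #|P| = 2%N /\
  exists C : bool -> {set bfun (2 * m)%N},
    [/\ injective C,
        P = [set C i | i : bool] &
        forall i : bool,
          C i :&: et_class q = [set g in et_class q | in_weight_class i g] /\
          C i :&: et_class q != set0].
Proof.
(* Weights are taken after normalization, since an added constant changes the weight but not the
   normalized Cayley graph. *)
move=> P; pose C i := [set g in ea_class q | in_weight_class i (normalize0 g)].
have memC g i :
    (g \in C i) = (g \in ea_class q) && in_weight_class i (normalize0 g).
  exact: in_set.
have CE i : C i :&: et_class q = [set g in et_class q | in_weight_class i g].
  apply/setP=> g; rewrite in_setI memC [in RHS]in_set andbC.
  apply: andb_id2l => gq.
  by rewrite (subsetP (et_class_sub q) _ gq) (normalize0_et gq).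
have witness i : exists g, g \in C i :&: et_class q.
  have [a wa] := shift_form_weight_class hm hbent i.
  by exists (shift_form q a); rewrite CE in_set shift_form_et.
have ec_class g i : g \in C i -> [set h in ea_class q | ec_equiv g h] = C i.
  rewrite memC => /andP[gq wg]; apply/setP=> h; rewrite memC in_set.
  apply: andb_id2l => hq.
  exact: (ec_equiv_weight_class hm hquad hbent gq hq wg).
have C_inj : injective C.
  move=> i j Cij; have [g /setIP[gi _]] := witness i.
  have gj : g \in C j by rewrite -Cij.
  move: gi gj; rewrite !memC => /andP[_ wi] /andP[_].
  by rewrite (in_weight_class_uniq j hm wi) => /eqP.
have PE : P = [set C i | i : bool].
  apply/setP=> X; apply/imsetP/imsetP => [[g gq ->]|[i _ ->]].
    have [i wg] := ea_weight_class hm hquad hbent gq.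
    by exists i => //; apply: ec_class; rewrite memC gq.
  have [g /setIP[gi _]] := witness i.
  exists g; last exact: esym (ec_class g i gi).
  by move: gi; rewrite memC => /andP[].
split; first by rewrite PE card_imset // card_bool.
exists C; split=> // i; split; first exact: CE.
by have [g gi] := witness i; apply/set0Pn; exists g.
Qed.
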